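(* Let $X$, $\mathcal{D}$, $\mathcal{D}^{\star}$, $l$, $\mathcal{F}(X)$, $\mathcal{T}_X$ be as defined in the context. For $f\in\mathcal{F}(X)$ define $$dom(\mathcal{D},X,f)=\left\{ g\in dom(\mathcal{D}^{\star}) : g(\cdot+l)f(\cdot)\in\mathcal{F}(X),\ \text{and}\ \mathbb{E}|f(X)\mathcal{D}^{\star}(g)(X)|<\infty \text{ or } \mathbb{E}|g(X)\mathcal{T}_Xf(X)|<\infty\right\}.$$ Then $$\mathbb{E}\left[f(X)\,\mathcal{D}^{\star}(g)(X)\right]=-\mathbb{E}\left[g(X)\,\mathcal{T}_Xf(X)\right]$$ for all $f\in\mathcal{F}(X)$ and all $g\in dom(\mathcal{D},X,f)$.
   Context: Setting. $(\mathcal{X},\mathcal{B},\mu)$ is a measure space with $\mathcal{X}\subset\mathbb{R}$, and $\mathcal{X}^{\star}$ is the set of real-valued functions on $\mathcal{X}$. $\mathcal{D}: dom(\mathcal{D})\subset\mathcal{X}^{\star}\to im(\mathcal{D})$ is a linear operator with $dom(\mathcal{D})\setminus\{0\}\neq\emptyset$. Assumption 1 (product rule): there are a linear operator $\mathcal{D}^{\star}:dom(\mathcal{D}^{\star})\subset\mathcal{X}^{\star}\to im(\mathcal{D}^{\star})$ and a constant $l$ (depending on $\mathcal{X},\mathcal{D}$) such that $\mathcal{D}(f(\cdot)g(\cdot+l))(x)=g(x)\,\mathcal{D}f(x)+f(x)\,\mathcal{D}^{\star}g(x)$ for all $(f,g)\in dom(\mathcal{D})\times dom(\mathcal{D}^{\star})$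 and all $x\in\mathcal{X}$. Here $g(\cdot+l)$ denotes $x\mapsto g(x+l)$. $X$ is a random variable on $\mathcal{X}$ whose law is absolutely continuous with respect to $\mu$ with density $p\in dom(\mathcal{D})$, whose support $\mathcal{I}=\{x\in\mathcal{X}: p(x)>0\}$ is an interval of $\mathcal{X}$ (the intersection of $\mathcal{X}$ with a finite or infinite real interval). $L^1_\mu(p)$ is the set of $h:\mathcal{X}\to\mathbb{R}$ with $\mathbb{E}|h(X)|=\int_{\mathcal{I}}|h|p\,d\mu<\infty$. The canonical Stein class $\mathcal{F}(X)$ is the set of $f\in L^1_\mu(p)$ such that (i) $fp\in dom(\mathcal{D})$, (ii) $\mathcal{D}(fp)\in L^1(\mu)$, (iii) $\int_{\mathcal{I}}\mathcal{D}(fp)\,d\mu=0$; it is assumed that $\mathcal{F}(X)\setminus\{0\}\ne\emptyset$. The canonical Stein operator is $\mathcal{T}_Xf=\mathcal{D}(fp)/p$ on $\mathcal{I}$ and $\mathcal{T}_Xf=0$ outside $\mathcal{I}$, for $f\in\mathcal{F}(X)$. *)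

(* Defs.v *)
From HB Require Import structures.
From mathcomp Require Import all_boot all_order all_algebra.
From mathcomp Require Import all_classical all_reals all_analysis.

Set Implicit Arguments.
Unset Strict Implicit.
Unset Printing Implicit Defensive.

Import Order.TTheory GRing.Theory Num.Theory.

Local Open Scope classical_set_scope.
Local Open Scope ring_scope.

(* A nonempty S : set R seen as a type; measurable types have to be pointed,
   whence the proof of nonemptiness among the parameters. *)
Definition carrier (R : realType) (S : set R) (S0 : S !=set0) : Type :=
  {x : R | x \in S}.

Section carrier_instances.
Variables (R : realType) (S : set R) (S0 : S !=set0).

HB.instance Definition _ := SubChoice.on (carrier S0).

Let carrier_point : carrier S0 :=
  let: exist x Sx := cid S0 in exist _ x (mem_set Sx).

HB.instance Definition _ := isPointed.Build (carrier S0) carrier_point.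

End carrier_instances.

(* A linear operator on real-valued functions over T, defined on the linear
   subspace [dom]; the values of [app] outside [dom] are meaningless. *)
Record linop (R : realType) (T : Type) := Linop {
  dom : set (T -> R) ;
  app :> (T -> R) -> (T -> R) ;
  dom_zero : dom (fun=> 0) ;
  dom_lin : forall (a b : R) (f g : T -> R), dom f -> dom g ->
    dom (fun x => a * f x + b * g x) ;
  app_lin : forall (a b : R) (f g : T -> R), dom f -> dom g ->
    forall x, app (fun y => a * f y + b * g y) x = a * app f x + b * app g x
}.

(* x |-> g (x + l); where x + l falls outside S, g is extended by 0. If
   S + l `<=` S, as is the case when g (. + l) makes sense literally, this
   convention plays no role. *)
Definition shift (R : realType) (S : set R) (S0 : S !=set0) (l : R)
    (g : carrier S0 -> R) : carrier S0 -> R :=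
  fun x => oapp g 0 (insub (val x + l) : option (carrier S0)).

(* [D (f * g(. + l))] is meaningful only when f * g(. + l) lies in the domain
   of D. *)
Definition product_rule (R : realType) (S : set R) (S0 : S !=set0)
    (D Dstar : linop R (carrier S0)) (l : R) : Prop :=
  forall f g, dom D f -> dom Dstar g -> dom D (f \* shift l g) ->
    forall x, D (f \* shift l g) x = g x * D f x + f x * Dstar g x.

Section stein.
Context {R : realType} {d : measure_display} {T : measurableType d}.
Variable mu : {measure set T -> \bar R}.

Definition is_density (nu : set T -> \bar R) (p : T -> R) : Prop :=
  [/\ measurable_fun [set: T] p,
      forall x, 0 <= p x &
      forall A, measurable A -> nu A = (\int[mu]_(x in A) (p x)%:E)%E].

Definition supp (p : T -> R) : set T := [set x | 0 < p x].

(* E|h(X)| < +oo for X of density p with respect to mu, i.e. h * p is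
   mu-integrable over the support of p. *)
Definition L1 (p : T -> R) : set (T -> R) :=
  [set h | mu.-integrable (supp p) (EFin \o (h \* p))].

Definition stein_class (D : linop R T) (p : T -> R) : set (T -> R) :=
  [set f | [/\ L1 p f,
               dom D (f \* p),
               mu.-integrable [set: T] (EFin \o D (f \* p)) &
               (\int[mu]_(x in supp p) (D (f \* p) x)%:E = 0)%E]].

End stein.

Definition stein_op (R : realType) (T : Type) (D : linop R T) (p : T -> R)
    (f : T -> R) : T -> R :=
  fun x => if 0 < p x then D (f \* p) x / p x else 0.

Definition stein_dom (R : realType) (S : set R) (S0 : S !=set0)
    (B : set (set (carrier S0)))
    (mu : {measure set (g_sigma_algebraType B) -> \bar R})
    (D Dstar : linop R (carrier S0)) (l : R) (p f : carrier S0 -> R) :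
    set (carrier S0 -> R) :=
  [set g | [/\ dom Dstar g,
               stein_class mu D p (shift l g \* f) &
               L1 mu p (f \* Dstar g) \/ L1 mu p (g \* stein_op D p f)]].

(* Main.v *)
Require Import Defs.
From HB Require Import structures.
From mathcomp Require Import all_boot all_order all_algebra.
From mathcomp Require Import all_classical all_reals all_analysis.
From mathcomp Require Import measurable_realfun.

Set Implicit Arguments.
Unset Strict Implicit.
Unset Printing Implicit Defensive.

Import Order.TTheory GRing.Theory Num.Theory.

Local Open Scope classical_set_scope.
Local Open Scope ring_scope.

(** The identity is integration by parts.  Put h := D (g(. + l) f p).  The
    product rule, applied to the pair (f p, g), gives on the support of p

      h = g D(f p) + f p Dstar(g) = (g T_X f) p + (f Dstar(g)) p,

    because D(f p) = (T_X f) p where p > 0 ([stein_integrand]).  That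
    g(. + l) f lies in the Stein class says that h is integrable and that its
    integral over the support is 0.  Hence, as soon as one of the two summands
    is integrable, so is the other ([integrableD_cancel]), and their integrals
    are opposite ([integral_opp_of_add_eq0]).

    It remains to read these integrals against mu as expectations:
    E[phi(X)] is the integral of phi p over the support of p
    ([expectation_density]).  Two points need care there.  First, mu is an
    arbitrary measure, outside the scope of the Radon-Nikodym theorem, so the
    change of density is proved from the simple functions up
    ([ge0_integral_density]).  Second, phi = f Dstar(g) is known to be
    measurable on the support of p only, and there only because phi p and p
    are; outside, phi is an arbitrary function.  Since X stays in the support
    almost surely, it is enough that the integral of an arbitrary function,
    measurable or not, does not depend on its values on a measurable null set
    ([integral_setC_null]). *)

Section integral_off_null_set.
Local Open Scope ereal_scope.
Context d (T : measurableType d) (R : realType).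
Variable mu : {measure set T -> \bar R}.

Import HBNNSimple.

(** The integral of a nonnegative F is the supremum of the integrals of the
    simple functions below F, whether or not F is measurable; cutting such a
    simple function off on a null set does not change its integral. *)
Lemma ge0_integral_setC_null (A : set T) (F : T -> \bar R) :
  measurable A -> mu (~` A) = 0 -> (forall x, 0 <= F x) ->
  \int[mu]_x F x = \int[mu]_(x in A) F x.
Proof.
move=> mA muA F0; rewrite [RHS]integral_mkcond !ge0_integralTE//; last first.
  exact: erestrict_ge0.
apply/eqP; rewrite eq_le; apply/andP; split; apply: ge_ereal_sup => _ [h hF <-].
  apply: ereal_sup_ubound => /=; exists (proj_nnsfun h mA).
    by move=> x; rewrite -mrestrict !patchE; case: ifPn.
  rewrite -mrestrict -integral_nnsfun// -[RHS]integralT_nnsfun.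
  rewrite (@ge0_negligible_integral _ _ _ mu setT (~` A))//.
  - by rewrite setTD setCK.
  - exact: measurableC.
  - exact/measurable_EFinP.
  - by move=> x _; rewrite lee_fin.
apply: ereal_sup_ubound; exists h => // x.
apply: (le_trans (hF x)); rewrite patchE; by case: ifPn.
Qed.

Lemma integral_setC_null (A : set T) (F : T -> \bar R) :
  measurable A -> mu (~` A) = 0 -> \int[mu]_x F x = \int[mu]_(x in A) F x.
Proof.
move=> mA muA; rewrite integralE [RHS]integralE.
by congr (_ - _); apply: ge0_integral_setC_null.
Qed.

End integral_off_null_set.

Section density.
Local Open Scope ereal_scope.
Context d (T : measurableType d) (R : realType).
Variables (mu nu : {measure set T -> \bar R}) (p : T -> R).
Hypothesis nup : is_density mu nu p.

Import HBNNSimple.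

Let mp : measurable_fun [set: T] (EFin \o p).
Proof. by apply/measurable_EFinP; case: nup. Qed.

Let p0 x : (0 <= p x)%R. Proof. by case: nup. Qed.

(** The density hypothesis is the case of an indicator; the general case
    follows by linearity over the finitely many values of h. *)
Lemma integral_density_nnsfun (h : {nnsfun T >-> R}) :
  \int[nu]_x (h x)%:E = \int[mu]_x ((h x)%:E * (p x)%:E).
Proof.
rewrite integralT_nnsfun sintegralE.
have hp0 y x : 0 <= (y * \1_(h @^-1` [set y]) x)%R%:E * (p x)%:E.
  by apply: mule_ge0; rewrite ?lee_fin// -lee_fin EFinM nnfun_muleindic_ge0.
transitivity (\int[mu]_x (\sum_(y \in range h)
    (y * \1_(h @^-1` [set y]) x)%R%:E * (p x)%:E)); last first.
  apply: eq_integral => x _; rewrite -ge0_mule_fsuml => [|y]; last first.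
    by rewrite EFinM nnfun_muleindic_ge0.
  by rewrite fsumEFin// -fimfunE.
rewrite ge0_integral_fsum//; last first.
  move=> y; apply: emeasurable_funM => //; apply/measurable_EFinP.
  exact: measurable_funM.
apply: eq_fsbigr => y /set_mem[x _ <-].
have [_ _ ->//] := nup.
transitivity (\int[mu]_z ((h x)%:E *
    ((EFin \o p) \_ (h @^-1` [set h x])) z)); last first.
  apply: eq_integral => z _.
  by rewrite epatch_indic/= EFinM [X in _ * X]muleC muleA.
rewrite ge0_integralZl//; last 3 first.
- by apply/(measurable_restrictT _ _).1 => //; exact: measurable_funTS.
- by move=> z _; apply: erestrict_ge0 => t _ /=; rewrite lee_fin.
- by rewrite lee_fin.
by rewrite -integral_mkcond.
Qed.

(** Monotone convergence on both sides, along simple functions increasing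
    to f. *)
Lemma ge0_integral_density (f : T -> \bar R) :
  measurable_fun [set: T] f -> (forall x, 0 <= f x) ->
  \int[nu]_x f x = \int[mu]_x (f x * (p x)%:E).
Proof.
move=> mf f0; pose h := nnsfun_approx measurableT mf.
have hf x : (h n x)%:E @[n --> \oo] --> f x.
  by apply: cvg_nnsfun_approx => // t _.
have ndh x : nondecreasing_seq (fun n => h n x).
  by move=> a b ab; exact/lefP/nd_nnsfun_approx.
transitivity (limn (fun n => \int[nu]_x (h n x)%:E)).
  rewrite -monotone_convergence//.
  - by apply: eq_integral => x _; apply/esym/cvg_lim => //; exact: hf.
  - by move=> n; exact/measurable_EFinP.
  - by move=> n x _; rewrite lee_fin.
  - by move=> x _ a b ab; rewrite lee_fin; exact: ndh.
under eq_fun do rewrite integral_density_nnsfun.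
rewrite -monotone_convergence//.
- apply: eq_integral => x _; apply/cvg_lim => //.
  by apply: cvgeZr => //; exact: hf.
- by move=> n; apply: emeasurable_funM => //; exact/measurable_EFinP.
- by move=> n x _; rewrite mule_ge0 ?lee_fin.
- by move=> x _ a b ab; rewrite lee_wpmul2r ?lee_fin//; exact: ndh.
Qed.

(** As p is nonnegative, multiplying by p commutes with taking positive and
    negative parts; when both parts of f have infinite integral, the two sides
    agree by the same convention for the difference of infinities. *)
Lemma integral_density (f : T -> R) : measurable_fun [set: T] f ->
  \int[nu]_x (f x)%:E = \int[mu]_x (f x * p x)%:E.
Proof.
move=> mf; have mEf : measurable_fun setT (EFin \o f) by exact/measurable_EFinP.
rewrite integralE [RHS]integralE; congr (_ - _).
- rewrite ge0_integral_density//; last exact: measurable_funepos.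
  apply: eq_integral => x _; rewrite !funeposE -!EFin_max -EFinM.
  by rewrite -[in RHS](mul0r (p x)) maxr_pMl.
- rewrite ge0_integral_density//; last exact: measurable_funeneg.
  apply: eq_integral => x _; rewrite !funenegE -!EFinN -!EFin_max -EFinM.
  by rewrite -mulNr -[in RHS](mul0r (p x)) maxr_pMl.
Qed.

End density.

Section expectation_density.
Import numFieldNormedType.Exports.
Context d (T : measurableType d) (R : realType).
Variables (mu : {measure set T -> \bar R}) (p : T -> R).
Context d' (Omega : measurableType d') (P : probability Omega R).
Variable X : {RV P >-> T}.
Hypothesis pX : is_density mu (distribution P X) p.

Let mp : measurable_fun [set: T] p. Proof. by case: pX. Qed.

Let p0 x : 0 <= p x. Proof. by case: pX. Qed.

Lemma measurable_supp : measurable (supp p).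
Proof.
have := @measurable_fun_ltr _ _ _ setT (cst 0) p (measurable_cst _) mp.
by move=> /(_ measurableT [set true]); rewrite setTI; apply.
Qed.

Lemma distribution_setC_supp : P (X @^-1` (~` supp p)) = 0%E.
Proof.
have [_ _ pXE] := pX.
rewrite -[LHS]/(distribution P X (~` supp p)) pXE; last first.
  exact/measurableC/measurable_supp.
apply: integral0_eq => x /negP; rewrite -leNgt => px.
by congr EFin; apply/le_anti; rewrite px p0.
Qed.

Lemma measurable_fun_of_mul_density (phi : T -> R) :
  measurable_fun (supp p) (phi \* p) -> measurable_fun (supp p) phi.
Proof.
move=> mphip.
(* The inverse of p is written as a real power, which is a measurable
   function on the whole line. *)
apply: (eq_measurable_fun (fun x => (phi x * p x) * (p x) `^ (-1))).
  by move=> x /set_mem px; rewrite powR_inv1// mulfK// gt_eqF.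
apply: measurable_funM => //; apply: measurable_funTS.
exact: (measurableT_comp (measurable_powR _)).
Qed.

(** Only the restriction psi of phi to the support is known to be measurable
    on the whole space.  The law of X gives no mass to the complement of the
    support, so phi(X) may be replaced by psi(X), to which the transfer to the
    law of X applies. *)
Lemma expectation_density (phi : T -> R) :
  measurable_fun (supp p) (phi \* p) ->
  ('E_P[fun w => phi (X w)] = \int[mu]_(x in supp p) (phi x * p x)%:E)%E.
Proof.
move=> /measurable_fun_of_mul_density mphi; have mS := measurable_supp.
have mXS : measurable (X @^-1` supp p).
  by rewrite -[X in measurable X]setTI; exact: measurable_funP.
rewrite unlock (integral_setC_null _ mXS); last exact: distribution_setC_supp.
pose psi := phi \_ (supp p).
have mpsi : measurable_fun [set: T] psi by exact/(measurable_restrictT _ mS).1.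
have mEpsi : measurable_fun [set: T] (EFin \o psi) by exact/measurable_EFinP.
transitivity (\int[P]_w ((EFin \o psi) \o X) w)%E.
  rewrite integral_mkcond; apply: eq_integral => w _.
  rewrite !patchE /= /psi patchE.
  have -> : (w \in X @^-1` supp p) = (X w \in supp p).
    by apply/idP/idP; rewrite !inE.
  by case: ifP.
transitivity (\int[distribution P X]_x (psi x)%:E)%E.
  rewrite integralE [RHS]integralE funepos_comp funeneg_comp.
  congr (_ - _)%E; rewrite ge0_integral_distribution//.
    exact: measurable_funepos.
  exact: measurable_funeneg.
rewrite (integral_density pX)// [RHS]integral_mkcond.
apply: eq_integral => x _; rewrite !patchE /psi patchE.
by case: ifP => //= _; rewrite mul0r.
Qed.

End expectation_density.

(** The product rule is used with f p, and not f, as its first factor: then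
    Dstar g is multiplied by f p, and D(f p) = (T_X f) p on the support. *)
Lemma stein_integrand (R : realType) (S : set R) (S0 : S !=set0)
    (D Dstar : linop R (carrier S0)) (l : R) (p f g : carrier S0 -> R) :
  product_rule D Dstar l -> dom D (f \* p) -> dom Dstar g ->
  dom D ((Defs.shift l g \* f) \* p) -> forall x, 0 < p x ->
  D ((Defs.shift l g \* f) \* p) x =
    f x * Dstar g x * p x + g x * stein_op D p f x * p x.
Proof.
move=> DDstar Dfp Dg.
have -> : (Defs.shift l g \* f) \* p = (f \* p) \* Defs.shift l g.
  by apply/funext => x /=; rewrite -mulrA mulrC.
move=> Dh x px; rewrite DDstar// /stein_op px.
rewrite -[g x * _ * p x]mulrA divfK ?gt_eqF//.
by rewrite addrC /= mulrAC.
Qed.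

Section integral_of_sum.
Local Open Scope ereal_scope.
Context d (T : measurableType d) (R : realType).
Variable mu : {measure set T -> \bar R}.

Lemma integrableD_cancel (A : set T) (u v h : T -> R) : measurable A ->
  (forall x, A x -> h x = (u x + v x)%R) ->
  mu.-integrable A (EFin \o h) -> mu.-integrable A (EFin \o u) ->
  mu.-integrable A (EFin \o v).
Proof.
move=> mA huv ih iu; have := integrableB mA ih iu; apply: eq_integrable => //.
by move=> x /set_mem Ax /=; rewrite huv// -EFinB addrAC subrr add0r.
Qed.

Lemma integral_opp_of_add_eq0 (A : set T) (u v h : T -> R) : measurable A ->
  (forall x, A x -> h x = (u x + v x)%R) ->
  mu.-integrable A (EFin \o u) -> mu.-integrable A (EFin \o v) ->
  \int[mu]_(x in A) (h x)%:E = 0 ->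
  \int[mu]_(x in A) (u x)%:E = - \int[mu]_(x in A) (v x)%:E.
Proof.
move=> mA huv iu iv.
rewrite (eq_integral (fun x => (u x)%:E + (v x)%:E)) => [|x /set_mem Ax].
  rewrite integralD_EFin// -(fineK (integrable_fin_num mA iu)).
  rewrite -(fineK (integrable_fin_num mA iv)) -EFinD -EFinN => -[/eqP].
  by rewrite addr_eq0 => /eqP ->.
by rewrite huv.
Qed.

End integral_of_sum.

Theorem proposition16 (R : realType)
    (* the measure space (S, B, mu), with S a subset of the real line *)
    (S : set R) (S0 : S !=set0)
    (B : set (set (carrier S0))) (sigmaB : sigma_algebra [set: carrier S0] B)
    (mu : {measure set (g_sigma_algebraType B) -> \bar R})
    (* the operators D and Dstar *)
    (D : linop R (carrier S0)) (D_nontrivial : (dom D `\ (fun=> 0)) !=set0)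
    (Dstar : linop R (carrier S0)) (l : R) (DDstar : product_rule D Dstar l)
    (* the random variable X, of density p with respect to mu *)
    (d : measure_display) (Omega : measurableType d) (P : probability Omega R)
    (X : {RV P >-> g_sigma_algebraType B}) (p : carrier S0 -> R)
    (p_density : is_density mu (distribution P X) p)
    (p_dom : dom D p)
    (p_supp : exists i : interval R,
      supp (p : g_sigma_algebraType B -> R) = [set x | val x \in i])
    (F_nontrivial : (stein_class mu D p `\ (fun=> 0)) !=set0) :
  forall f, stein_class mu D p f ->
  forall g, stein_dom mu D Dstar l p f g ->
  ('E_P[fun w => (f (X w) * Dstar g (X w))%R] =
    - 'E_P[fun w => (g (X w) * stein_op D p f (X w))%R])%E.
Proof.
move=> f [_ Dfp _ _] g [Dg [_ Dh iDh intDh] L1fg].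
have mS := measurable_supp p_density.
have hE := stein_integrand DDstar Dfp Dg Dh.
have ih := integrableS measurableT mS (@subsetT _ _) iDh.
have [iu iv] : L1 mu p (f \* Dstar g) /\ L1 mu p (g \* stein_op D p f).
  case: L1fg => [iu|iv]; split => //.
    exact: integrableD_cancel mS hE ih iu.
  apply: integrableD_cancel mS _ ih iv => x px.
  by rewrite hE// addrC.
have mEP u : mu.-integrable (supp (p : g_sigma_algebraType B -> R))
      (EFin \o u) ->
    measurable_fun (supp (p : g_sigma_algebraType B -> R)) u.
  by move=> /measurable_int /measurable_EFinP.
rewrite (expectation_density p_density (mEP _ iu)).
rewrite (expectation_density p_density (mEP _ iv)).
exact: integral_opp_of_add_eq0 mS hE iu iv intDh.
Qed.
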